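(* Let $G$ and $H$ be finitely generated quasi-isometric groups. If $P\le G$ is a qi-subcharacteristic subgroup, then there is a qi-subcharacteristic subgroup $Q\le H$ such that $\tilde e(G,P)=\tilde e(H,Q)$.
   Context: Finitely generated groups are equipped with a chosen word metric $\mathsf{dist}_G$ (with respect to a finite generating set, left-invariant); $\mathsf{hdist}_G$ denotes the Hausdorff distance (possibly infinite) between subsets of $G$. For a collection $\mathcal{P}$ of subgroups of $G$, $G/\mathcal{P}$ denotes the set of left cosets $gP$ with $g\in G$, $P\in\mathcal{P}$. A map $q\colon X\to Y$ of metric spaces is $(L,C)$-coarse Lipschitz if $\mathsf{dist}(q(x),q(y))\le L\,\mathsf{dist}(x,y)+C$ for all $x,y$. It is an $(L,C)$-quasi-isometry if it is $(L,C)$-coarse Lipschitz and there is an $(L,C)$-coarse Lipschitz map $\bar q\colon Y\to X$ with $\mathsf{dist}(\bar q q(x),x)\le C$ and $\mathsf{dist}(q\bar q(y),y)\le C$ for all $x,y$. An $(L,C)$-quasi-isometry $q\colon G\to G$ is an $(L,C,M)$-quasi-isometry of pairs $(G,\mathcal{P})\to(G,\mathcal{P})$ if for every $A\in G/\mathcal{P}$ there is $B\in G/\mathcal{P}$ with $\mathsf{hdist}_G(q(A),B)<M$, and for every $B\in G/\mathcal{P}$ there is $A\in G/\mathcal{P}$ with $\mathsf{hdist}_G(q(A),B)<M$. The commensurator of $P\le G$ is $Comm_G(P)=\{g\in G : P\cap gPg^{-1}$ has finite index in both $P$ and $gPg^{-1}\}$. A collection $\mathcal{P}$ of subgroups of $G$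 is qi-characteristic if $\mathcal{P}$ is finite, each $P\in\mathcal{P}$ has finite index in its commensurator, and for all $L\ge1$, $C\ge0$ there is $M=M(L,C)>0$ such that every $(L,C)$-quasi-isometry $q\colon G\to G$ is an $(L,C,M)$-quasi-isometry of pairs $(G,\mathcal{P})\to(G,\mathcal{P})$. A subgroup $P\le G$ is qi-subcharacteristic if it belongs to some qi-characteristic collection of subgroups of $G$. Filtered ends. Let $X$ be a metric space and $C\subseteq X$ non-empty; $C^{+\mu}$ is the open $\mu$-neighborhood of $C$. A subset $A$ is $\sigma$-coarsely connected if any two points of $A$ are joined by a finite sequence of points of $A$ with consecutive distances $\le\sigma$. For a metric space $Z$, let $\mathcal{C}_\infty(Z,\sigma)$ be the set of unbounded $\sigma$-coarsely connected components of $Z$. For $\mu\le\mu'$ there is a map $\mathcal{C}_\infty(X-C^{+\mu'},\sigma)\to\mathcal{C}_\infty(X-C^{+\mu},\sigma)$ sending a component to the one containing it; let $\mathsf{E}(X,C,\sigma)=\varprojlim_{\mu}\mathcal{C}_\infty(X-C^{+\mu},\sigma)$. For $\sigma\le\sigma'$ inclusion of components induces $\varphi_{\sigma,\sigma'}\colon\mathsf{E}(X,C,\sigma)\to\mathsf{E}(X,C,\sigma')$, and $\mathsf{E}(X,C)=\varinjlim_\sigma\mathsf{E}(X,C,\sigma)$. For a finitely generated group $G$ and $P\le G$, the number of filtered ends $\tilde e(G,P)$ is the cardinality of $\mathsf{E}(X,P)$, where $X$ is a Cayley graph of $G$ with respect to a finite generating set, with the edge path metric (this is independent of the choice of $X$).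 *)

(* Defs.v *)
From HB Require Import structures.
From mathcomp Require Import all_boot all_order all_algebra.
From mathcomp Require Import all_classical all_reals ereal.

Set Implicit Arguments.
Unset Strict Implicit.
Unset Printing Implicit Defensive.

Import Order.TTheory GRing.Theory Num.Theory.

Local Open Scope classical_set_scope.
Local Open Scope ring_scope.

(* A metric space is given by a type X and its distance function
   d : X -> X -> R; none of the notions below uses the induced topology. *)

Section CoarseMaps.
Context {R : realType}.

Definition coarse_lipschitz (X Y : Type) (dX : X -> X -> R) (dY : Y -> Y -> R)
    (L C : R) (q : X -> Y) : Prop :=
  forall x y, dY (q x) (q y) <= L * dX x y + C.

Definition quasi_isometry (X Y : Type) (dX : X -> X -> R) (dY : Y -> Y -> R)
    (L C : R) (q : X -> Y) : Prop :=
  coarse_lipschitz dX dY L C q /\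
  exists qbar : Y -> X,
    [/\ coarse_lipschitz dY dX L C qbar,
        forall x, dX (qbar (q x)) x <= C &
        forall y, dY (q (qbar y)) y <= C].

Definition quasi_isometric (X Y : Type) (dX : X -> X -> R) (dY : Y -> Y -> R) :
    Prop :=
  exists (L C : R) (q : X -> Y), quasi_isometry dX dY L C q.

Definition closed_nbhd (X : Type) (d : X -> X -> R) (r : R) (A : set X) :
    set X :=
  [set x | exists2 a, A a & d x a <= r].

Definition open_nbhd (X : Type) (d : X -> X -> R) (r : R) (A : set X) : set X :=
  [set x | exists2 a, A a & d x a < r].

(* +oo (the infimum of the empty set) when A and B are not at finite
   distance. *)
Definition hdist (X : Type) (d : X -> X -> R) (A B : set X) : \bar R :=
  ereal_inf [set r%:E | r in [set r : R |
    [/\ 0 <= r, A `<=` closed_nbhd d r B & B `<=` closed_nbhd d r A]]].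

End CoarseMaps.

Section Subgroups.
Local Open Scope group_scope.
Context {G : groupType}.

Definition is_subgroup (P : set G) : Prop := group_closed (mem P).

Definition lcoset (g : G) (A : set G) : set G := [set g * x | x in A].

Definition conjugate (g : G) (A : set G) : set G := [set g * x * g^-1 | x in A].

Definition finite_index (K A : set G) : Prop :=
  finite_set [set lcoset a K | a in A].

Definition commensurator (P : set G) : set G :=
  [set g | finite_index (P `&` conjugate g P) P /\
           finite_index (P `&` conjugate g P) (conjugate g P)].

Definition cosets (PP : set (set G)) : set (set G) :=
  [set A | exists g P, PP P /\ A = lcoset g P].

End Subgroups.

Section WordMetric.
Local Open Scope group_scope.
Context {G : groupType}.

(* g is a product of n letters taken from the elements of S and their
   inverses. *)
Definition word_of_length (S : seq G) (g : G) (n : nat) : Prop :=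
  exists w : seq G,
    [/\ size w = n, all (fun x => (x \in S) || (x^-1 \in S)) w &
        \prod_(x <- w) x = g].

Definition generates (S : seq G) : Prop :=
  forall g, exists n, word_of_length S g n.

Lemma word_of_length_ex (S : seq G) (g : G) :
  (exists n, word_of_length S g n) -> exists n, `[< word_of_length S g n >].
Proof. by move=> [n Sn]; exists n; apply/asboolP. Qed.

(* The value 0 on elements that are not words in S is irrelevant when S
   generates G. *)
Definition word_length (S : seq G) (g : G) : nat :=
  if pselect (exists n, word_of_length S g n) is left ex
  then ex_minn (word_of_length_ex ex) else 0%N.

Definition word_dist (R : realType) (S : seq G) (g h : G) : R :=
  (word_length S (g^-1 * h))%:R%R.

End WordMetric.

Section QICharacteristic.
Context (R : realType) {G : groupType} (S : seq G).

Local Notation dist := (word_dist R S).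

Definition quasi_isometry_of_pairs (PP : set (set G)) (L C M : R)
    (q : G -> G) : Prop :=
  [/\ quasi_isometry dist dist L C q,
      forall A, cosets PP A ->
        exists2 B, cosets PP B & (hdist dist (q @` A) B < M%:E)%E &
      forall B, cosets PP B ->
        exists2 A, cosets PP A & (hdist dist (q @` A) B < M%:E)%E].

Definition qi_characteristic (PP : set (set G)) : Prop :=
  [/\ forall P, PP P -> is_subgroup P,
      finite_set PP,
      forall P, PP P -> finite_index P (commensurator P) &
      forall L C : R, 1 <= L -> 0 <= C ->
        exists2 M : R, 0 < M &
          forall q : G -> G, quasi_isometry dist dist L C q ->
            quasi_isometry_of_pairs PP L C M q].

Definition qi_subcharacteristic (P : set G) : Prop :=
  exists2 PP : set (set G), qi_characteristic PP & PP P.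

End QICharacteristic.

Section FilteredEnds.
Context {R : realType} {X : Type} (d : X -> X -> R).

Definition joined (A : set X) (sigma : R) (x y : X) : Prop :=
  exists s : seq X,
    [/\ all (fun z => `[< A z >]) (x :: s),
        path (fun a b => d a b <= sigma) x s &
        last x s = y].

Definition coarse_component (A : set X) (sigma : R) (K : set X) : Prop :=
  exists2 x, A x & K = [set y | joined A sigma x y].

Definition unbounded (K : set X) : Prop :=
  ~ exists D : R, forall x y, K x -> K y -> d x y <= D.

Definition unbounded_components (A : set X) (sigma : R) : set (set X) :=
  [set K | coarse_component A sigma K /\ unbounded K].

(* When a subset K of A is sigma'-coarsely connected in A for some
   sigma' <= sigma, this is the sigma-component of A containing K. *)
Definition enclosing_component (A : set X) (sigma : R) (K : set X) : set X :=
  [set y | exists2 x, K x & joined A sigma x y].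

Context (C : set X).

Definition outside (mu : R) : set X := ~` open_nbhd d mu C.

(* The inverse limit over mu > 0, as the set of coherent families of unbounded
   components. *)
Definition ends_at_scale (sigma : R) : set ({posnum R} -> set X) :=
  [set x | (forall mu : {posnum R},
              unbounded_components (outside mu%:num) sigma (x mu)) /\
           (forall mu mu' : {posnum R}, mu%:num <= mu'%:num ->
              enclosing_component (outside mu%:num) sigma (x mu') = x mu)].

(* The map phi_(sigma, sigma'), where sigma is the scale of x. *)
Definition rescale (sigma' : R) (x : {posnum R} -> set X) :
    {posnum R} -> set X :=
  fun mu => enclosing_component (outside mu%:num) sigma' (x mu).

(* The direct limit over sigma > 0, as the set of classes of pairs
   (scale, end at that scale) under eventual equality. *)
Definition scaled_ends : set ({posnum R} * ({posnum R} -> set X)) :=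
  [set p | ends_at_scale p.1%:num p.2].

Definition same_end (p q : {posnum R} * ({posnum R} -> set X)) : Prop :=
  exists rho : {posnum R},
    [/\ p.1%:num <= rho%:num, q.1%:num <= rho%:num &
        rescale rho%:num p.2 = rescale rho%:num q.2].

Definition filtered_ends : set (set ({posnum R} * ({posnum R} -> set X))) :=
  [set c | exists2 p, scaled_ends p &
             c = [set q | scaled_ends q /\ same_end p q]].

End FilteredEnds.

(* The Cayley graph as a geometric graph: its vertices, and the points at
   distance t from g and 1 - t from g * s, 0 < t < 1, on the unit-length edge
   that joins g to g * s, for s in S. *)
Inductive cayley_graph (R : realType) (G : groupType) (S : seq G) : Type :=
| Vertex of G
| EdgePoint (g s : G) (t : R) of s \in S & 0 < t < 1.

Arguments Vertex {R G S} g.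
Arguments EdgePoint {R G S} g s t _ _.

Section CayleyGraph.
Context (R : realType) {G : groupType} (S : seq G).

Local Notation X := (cayley_graph R S).

Definition dist_to_vertex (p : X) (h : G) : R :=
  match p with
  | Vertex g => word_dist R S g h
  | EdgePoint g s t _ _ =>
      Num.min (t + word_dist R S g h) ((1 - t) + word_dist R S (g * s)%g h)
  end.

(* A shortest path to a point of an edge enters that edge through one of its
   endpoints, unless it stays inside the edge. *)
Definition edge_path_dist (p q : X) : R :=
  match q with
  | Vertex h => dist_to_vertex p h
  | EdgePoint h u r _ _ =>
      let through_endpoint :=
        Num.min (r + dist_to_vertex p h)
                ((1 - r) + dist_to_vertex p (h * u)%g) in
      match p with
      | Vertex _ => through_endpoint
      | EdgePoint g s t _ _ =>
          if (g == h) && (s == u) then Num.min `|t - r| through_endpoint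
          else through_endpoint
      end
  end.

Definition filtered_ends_of_pair (P : set G) :=
  filtered_ends edge_path_dist ([set Vertex g | g in P]).

End CayleyGraph.

Arguments filtered_ends_of_pair R {G} S P.

(* Main.v *)
(* Let q : G -> H be a quasi-isometry with coarse inverse q', and let PP be a
   qi-characteristic collection containing P.  Since q' f q is a quasi-isometry
   of G with controlled constants for every quasi-isometry f of H, the images
   q(A) of the cosets A in G/PP form a family of subsets of H that is permuted,
   up to uniformly bounded Hausdorff distance, by the quasi-isometries of H, and
   in particular by its left translations.  The stabilizer in H of the coarse
   class of a member q(A) is a subgroup at finite Hausdorff distance from q(A)
   and equal to its own commensurator; finitely many such stabilizers, one of
   them for A = P, have cosets uniformly close to all the members of the family,
   so that they form a qi-characteristic collection.  Finally, filtered ends are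
   invariant under quasi-isometries of pairs. *)

Require Import Defs.
From mathcomp Require Import all_boot all_order all_algebra.
From mathcomp Require Import all_classical all_reals.
From mathcomp Require Import ereal lra.

Set Implicit Arguments.
Unset Strict Implicit.
Unset Printing Implicit Defensive.

Import Order.TTheory GRing.Theory Num.Theory.

Local Open Scope classical_set_scope.
Local Open Scope card_scope.

(** * Filtered ends *)

Section Joined.
Local Open Scope ring_scope.
Context {R : realType} {X : Type} (d : X -> X -> R).
Implicit Types (A B : set X) (r s : R).

Lemma joinedxx A r x : A x -> joined d A r x x.
Proof. by move=> Ax; exists [::]; split=> //=; rewrite andbT; apply/asboolP. Qed.

Lemma joined_cons A r x y z :
  A x -> d x y <= r -> joined d A r y z -> joined d A r x z.
Proof.
move=> Ax xy [s [As ps <-]]; exists (y :: s); split=> //=.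
- by rewrite -/(all _ (y :: s)) As andbT; apply/asboolP.
- by rewrite xy.
Qed.

Lemma joined_ind A r (Q : X -> X -> Prop) :
  (forall x, A x -> Q x x) ->
  (forall x y z, A x -> d x y <= r -> joined d A r y z -> Q y z -> Q x z) ->
  forall x y, joined d A r x y -> Q x y.
Proof.
move=> Q0 QS x y [s]; elim: s x => [|z s IHs] x [/= /andP[/asboolP Ax As]].
  by move=> _ <-; apply: Q0.
move=> /andP[xz ps] sy; apply: (QS _ z) => //; first by exists s.
exact: IHs.
Qed.

Lemma joinedl A r x y : joined d A r x y -> A x.
Proof. by elim/joined_ind. Qed.

Lemma joinedr A r x y : joined d A r x y -> A y.
Proof. by elim/joined_ind. Qed.

Lemma joined_step A r x y : A x -> A y -> d x y <= r -> joined d A r x y.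
Proof. by move=> Ax Ay xy; apply: (joined_cons Ax xy); apply: joinedxx. Qed.

Lemma joined_trans A r y x z :
  joined d A r x y -> joined d A r y z -> joined d A r x z.
Proof.
elim/joined_ind => // {}x {}y t Ax xy _ IH tz.
exact: joined_cons Ax xy (IH tz).
Qed.

Lemma joined_sym A r x y : (forall x y, d x y = d y x) ->
  joined d A r x y -> joined d A r y x.
Proof.
move=> dC; elim/joined_ind => [{}x Ax|{}x z {}y Ax xz zy yz].
  exact: joinedxx.
apply: joined_trans yz _; apply: joined_step => //; last by rewrite dC.
exact: joinedl zy.
Qed.

End Joined.

Lemma joined_map (R : realType) (X Y : Type) (dX : X -> X -> R) (dY : Y -> Y -> R)
    (f : X -> Y) (A : set X) (B : set Y) (r s : R) :
  A `<=` f @^-1` B ->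
  (forall x y, (dX x y <= r)%R -> (dY (f x) (f y) <= s)%R) ->
  forall x y, joined dX A r x y -> joined dY B s (f x) (f y).
Proof.
move=> AB rs; apply: joined_ind => [x Ax|x z y Ax xz _].
  by apply: joinedxx; apply: AB.
by apply: joined_cons; [apply: AB | apply: rs].
Qed.

Lemma joined_sub (R : realType) (X : Type) (d : X -> X -> R)
    (A B : set X) (r s : R) x y :
  A `<=` B -> (r <= s)%R -> joined d A r x y -> joined d B s x y.
Proof.
move=> AB rs; apply: (joined_map (f := id)) => // {}x {}y xy.
exact: le_trans xy rs.
Qed.

Lemma joined_le (R : realType) (X : Type) (d : X -> X -> R)
    (A : set X) (r s : R) x y :
  (r <= s)%R -> joined d A r x y -> joined d A s x y.
Proof. by move=> rs; apply: joined_sub rs => //; apply: subset_refl. Qed.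

Section EndsAtScale.
Local Open Scope ring_scope.
Context {R : realType} {X : Type} (d : X -> X -> R) (C : set X).
Hypothesis dC : forall x y, d x y = d y x.
Implicit Types (mu nu : {posnum R}) (r : R).
Implicit Types p : {posnum R} * ({posnum R} -> set X).

Lemma sub_outside (mu nu : R) : mu <= nu -> outside d C nu `<=` outside d C mu.
Proof.
move=> munu x xnu [c Cc xc]; apply: xnu; exists c => //.
exact: lt_le_trans xc munu.
Qed.

Lemma end_nonempty p mu : scaled_ends d C p -> exists a, p.2 mu a.
Proof.
by case=> /(_ mu)[[a Ca ->] _] _; exists a; apply: joinedxx.
Qed.

Lemma end_joined p mu a b : scaled_ends d C p ->
  p.2 mu a -> p.2 mu b -> joined d (outside d C mu%:num) p.1%:num a b.
Proof.
case=> /(_ mu)[[c Cc ->] _] _ ca cb.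
exact: joined_trans (joined_sym dC ca) cb.
Qed.

Lemma end_outside p mu a : scaled_ends d C p ->
  p.2 mu a -> outside d C mu%:num a.
Proof. by case=> /(_ mu)[[c Cc ->] _] _; apply: joinedr. Qed.

Lemma end_le p mu nu : scaled_ends d C p -> mu%:num <= nu%:num ->
  p.2 nu `<=` p.2 mu.
Proof.
move=> pE munu a pa; have [_ coh] := pE; rewrite -(coh _ _ munu); exists a => //.
by apply: joinedxx; apply: sub_outside munu _ _; apply: end_outside pE pa.
Qed.

(** Since [x] and [y] are coarsely connected, one joined pair links all their points. Equality of
    two ends at a given depth is thus checked on a single pair. *)
Lemma eq_enclosing (x y : set X) mu (r s t : R) a b :
  (forall a b, x a -> x b -> joined d (outside d C mu%:num) r a b) ->
  (forall a b, y a -> y b -> joined d (outside d C mu%:num) s a b) ->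
  r <= t -> s <= t -> x a -> y b -> joined d (outside d C mu%:num) t a b ->
  enclosing_component d (outside d C mu%:num) t x =
  enclosing_component d (outside d C mu%:num) t y.
Proof.
move=> xJ yJ rt st xa yb ab; apply/seteqP; split=> c [e xe ec].
  exists b => //; apply: joined_trans (joined_sym dC ab) _.
  by apply: joined_trans ec; apply: joined_le rt _; apply: xJ.
exists a => //; apply: joined_trans ab _.
by apply: joined_trans ec; apply: joined_le st _; apply: yJ.
Qed.

End EndsAtScale.

(** * Maps induced on ends *)

Section EndImage.
Local Open Scope ring_scope.
Context {R : realType}.

(* The map induced by f on ends, as a relation: its values depend on choices of
   scales that only the passage to [same_end] classes makes irrelevant. *)
Definition end_image (X Y : Type) (dY : Y -> Y -> R) (D : set Y) (f : X -> Y)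
    (p : {posnum R} * ({posnum R} -> set X))
    (p' : {posnum R} * ({posnum R} -> set Y)) : Prop :=
  exists r : R, forall nu : {posnum R}, exists mu : {posnum R},
    p.2 mu `<=`
    f @^-1` [set y | exists2 b, p'.2 nu b & joined dY (outside dY D nu%:num) r y b].

Definition addp (mu nu : {posnum R}) : {posnum R} := (mu%:num + nu%:num)%:pos.

Lemma num_addp mu nu : (addp mu nu)%:num = mu%:num + nu%:num.
Proof. by []. Qed.

Definition controlled (X Y : Type) (dX : X -> X -> R) (dY : Y -> Y -> R)
    (f : X -> Y) : Prop :=
  forall r, exists s, forall x y, dX x y <= r -> dY (f x) (f y) <= s.

(** By contraposition: the preimage of each neighborhood of [D] lies in a neighborhood of [C]. *)
Definition relatively_proper (X Y : Type) (dX : X -> X -> R) (dY : Y -> Y -> R)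
    (C : set X) (D : set Y) (f : X -> Y) : Prop :=
  forall nu : R, exists mu : {posnum R},
    outside dX C mu%:num `<=` f @^-1` outside dY D nu.

Lemma end_image_uniq (X Y : Type) (dX : X -> X -> R) (dY : Y -> Y -> R)
    (C : set X) (D : set Y) (f : X -> Y) p p1 p2 :
  (forall x y, dX x y = dX y x) -> (forall x y, dY x y = dY y x) ->
  scaled_ends dX C p -> scaled_ends dY D p1 -> scaled_ends dY D p2 ->
  end_image dY D f p p1 -> end_image dY D f p p2 -> same_end dY D p1 p2.
Proof.
move=> dXC dYC pE p1E p2E [r1 f1] [r2 f2].
(* This sum is a common scale above all four; the absolute values are there because [r1] and [r2]
   carry no sign condition. *)
have t_gt0 : 0 < p1.1%:num + p2.1%:num + `|r1| + `|r2|.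
  by apply: ltr_pwDl => //; apply: ltr_pwDl.
have le1 : p1.1%:num <= p1.1%:num + p2.1%:num + `|r1| + `|r2|.
  have := (gt0 p2.1, normr_ge0 r1, normr_ge0 r2) => -[[]]; lra.
have le2 : p2.1%:num <= p1.1%:num + p2.1%:num + `|r1| + `|r2|.
  have := (gt0 p1.1, normr_ge0 r1, normr_ge0 r2) => -[[]]; lra.
have le3 : r1 <= p1.1%:num + p2.1%:num + `|r1| + `|r2|.
  have := (gt0 p1.1, gt0 p2.1, ler_norm r1, normr_ge0 r2) => -[[[]]]; lra.
have le4 : r2 <= p1.1%:num + p2.1%:num + `|r1| + `|r2|.
  have := (gt0 p1.1, gt0 p2.1, ler_norm r2, normr_ge0 r1) => -[[[]]]; lra.
exists (PosNum t_gt0); split=> //=; apply/funext => nu; rewrite /rescale /=.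
have [mu1 {}f1] := f1 nu; have [mu2 {}f2] := f2 nu.
(* A point of [p] at depth [mu1 + mu2] serves both relations, so [f a] is joined to [p1] and to
   [p2]. *)
have [a pa] := end_nonempty (addp mu1 mu2) pE.
have /f1[b pb ab] : p.2 mu1 a.
  by apply: (end_le pE) pa; rewrite num_addp lerDl.
have /f2[c pc ac] : p.2 mu2 a.
  by apply: (end_le pE) pa; rewrite num_addp lerDr.
apply: (eq_enclosing dYC _ _ le1 le2 pb pc).
- by move=> ? ?; apply: end_joined.
- by move=> ? ?; apply: end_joined.
apply: (joined_trans (y := f a)).
  by apply: joined_sym => //; apply: joined_le ab.
exact: joined_le ac.
Qed.

Lemma end_image_id (X : Type) (d : X -> X -> R) (C : set X) p :
  (forall x y, d x y = d y x) ->
  scaled_ends d C p -> end_image d C id p p.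
Proof.
move=> dC pE; exists 0 => nu; exists nu => a pa; exists a => //=.
by apply: joinedxx; apply: end_outside pE pa.
Qed.

Lemma end_image_comp (X Y Z : Type) (dY : Y -> Y -> R) (dZ : Z -> Z -> R)
    (D : set Y) (E : set Z)
    (f : X -> Y) (g : Y -> Z) p p1 p2 :
  (forall x y, dY x y = dY y x) ->
  scaled_ends dY D p1 -> controlled dY dZ g -> relatively_proper dY dZ D E g ->
  end_image dY D f p p1 -> end_image dZ E g p1 p2 ->
  end_image dZ E (g \o f) p p2.
Proof.
move=> dYC p1E gc gp [rf fi] [rg gi]; have [s gs] := gc rf.
exists (Num.max s rg) => nu; have [mu1 {}gi] := gi nu.
have [mu2 {}gp] := gp nu%:num.
(* Depth [mu1] puts [b] where [g] leads to [p2]; depth [mu2] keeps the image under [g] of the chain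
   from [f a] to [b] outside the [nu]-neighborhood of [E]. *)
have [mu {}fi] := fi (addp mu1 mu2).
exists mu => a /fi[b pb ab]; have /gi[c pc bc] : p1.2 mu1 b.
  by apply: (end_le p1E) pb; rewrite num_addp lerDl.
exists c => //; apply: (joined_trans (y := g b)).
  have: joined dZ (outside dZ E nu%:num) s (g (f a)) (g b).
    apply: joined_map gs _ _ ab; apply: subset_trans gp.
    by apply: sub_outside; rewrite num_addp lerDr.
  by apply: joined_le; rewrite // le_max lexx.
by apply: joined_le bc; rewrite // le_max lexx orbT.
Qed.

(** A jump of length at most [K] from [g a] to [f a] is put in front of the chain that starts at
    [f a]; properness keeps both points outside the neighborhood. *)
Lemma end_image_close (X Y : Type) (dX : X -> X -> R) (dY : Y -> Y -> R)
    (C : set X) (D : set Y) (f g : X -> Y) (K : R) p p1 :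
  (forall x y, dX x y = dX y x) ->
  scaled_ends dX C p ->
  relatively_proper dX dY C D f -> relatively_proper dX dY C D g ->
  (forall x, dY (g x) (f x) <= K) ->
  end_image dY D f p p1 -> end_image dY D g p p1.
Proof.
move=> dXC pE fp gp gfK [r fi]; exists (Num.max r K) => nu.
have [mu1 {}fi] := fi nu; have [mu2 {}fp] := fp nu%:num.
have [mu3 {}gp] := gp nu%:num.
exists (addp (addp mu1 mu2) mu3) => a pa.
have := (gt0 mu1, gt0 mu2, gt0 mu3) => -[[mu1_gt0 mu2_gt0] mu3_gt0].
have /fi[b pb ab] : p.2 mu1 a by apply: (end_le pE) pa; rewrite !num_addp; lra.
have aout := end_outside pE pa.
exists b => //; apply: (@joined_cons _ _ _ _ _ _ (f a)).
- by apply: gp; apply: sub_outside aout; rewrite !num_addp; lra.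
- by rewrite le_max gfK orbT.
- by apply: joined_le ab; rewrite // le_max lexx.
Qed.

(** At depth [nu], the image end is the component containing the images of all sufficiently deep
    parts of [p]. *)
Lemma end_image_ex (X Y : Type) (dX : X -> X -> R) (dY : Y -> Y -> R)
    (C : set X) (D : set Y) (f : X -> Y) p :
  (forall x y, dX x y = dX y x) -> (forall x y, dY x y = dY y x) ->
  (forall K : set Y, ~ unbounded dY K ->
     exists nu : {posnum R}, forall y, K y -> ~ outside dY D nu%:num y) ->
  controlled dX dY f -> relatively_proper dX dY C D f ->
  scaled_ends dX C p -> exists2 p1, scaled_ends dY D p1 & end_image dY D f p p1.
Proof.
move=> dXC dYC far fc fp pE; have [s0 fs0] := fc p.1%:num.
have s_gt0 : 0 < Num.max s0 1 by rewrite lt_max ltr01 orbT.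
pose s := PosNum s_gt0.
have fs x y : dX x y <= p.1%:num -> dY (f x) (f y) <= s%:num.
  by move=> /fs0 xy; rewrite le_max xy.
(* Letting [mu] range over all good depths in [q] avoids choosing one for each [nu]; this makes the
   coherence of [q] immediate. *)
pose good (nu mu : {posnum R}) := outside dX C mu%:num `<=` f @^-1` outside dY D nu%:num.
pose q (nu : {posnum R}) := [set b | exists mu, exists2 a, good nu mu /\ p.2 mu a &
   joined dY (outside dY D nu%:num) s%:num (f a) b].
have good_joined nu mu mu' a a' : good nu mu -> good nu mu' ->
    p.2 mu a -> p.2 mu' a' ->
    joined dY (outside dY D nu%:num) s%:num (f a) (f a').
  move=> gmu gmu' pa pa'.
  have [e pe] := end_nonempty (addp mu mu') pE.
  have pe1 : p.2 mu e by apply: (end_le pE) pe; rewrite num_addp lerDl.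
  have pe2 : p.2 mu' e by apply: (end_le pE) pe; rewrite num_addp lerDr.
  apply: (joined_trans (y := f e)).
    by apply: joined_map gmu fs _ _ _; apply: end_joined pE pa pe1.
  by apply: joined_map gmu' fs _ _ _; apply: end_joined pE pe2 pa'.
have q_joined nu b b' : q nu b -> q nu b' ->
    joined dY (outside dY D nu%:num) s%:num b b'.
  move=> [mu [a [gmu pa] ab]] [mu' [a' [gmu' pa'] ab']].
  apply: joined_trans (joined_sym dYC ab) _; apply: joined_trans ab'.
  exact: good_joined gmu gmu' pa pa'.
have q_closed nu b b' : q nu b ->
    joined dY (outside dY D nu%:num) s%:num b b' -> q nu b'.
  move=> [mu [a gpa ab]] bb'; exists mu; exists a => //.
  exact: joined_trans ab bb'.
have q_in nu mu a : good nu mu -> p.2 mu a -> q nu (f a).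
  move=> gmu pa; exists mu; exists a => //; apply: joinedxx; apply: gmu.
  exact: end_outside pE pa.
have q_ne nu : exists b, q nu b.
  have [mu gmu] := fp nu%:num; have [a pa] := end_nonempty mu pE.
  by exists (f a); apply: q_in pa.
have q_le nu nu' : nu%:num <= nu'%:num -> q nu' `<=` q nu.
  move=> le_nu b [mu [a [gmu pa] ab]]; exists mu; exists a; last first.
    by apply: joined_sub ab => //; apply: sub_outside.
  by split=> //; apply: subset_trans gmu _ => x; apply: sub_outside.
exists (s, q); last first.
  exists 0 => nu; have [mu gmu] := fp nu%:num; exists mu => a pa /=.
  exists (f a); first exact: q_in pa.
  by apply: joinedxx; apply: gmu; apply: end_outside pE pa.
split=> [nu|nu nu' le_nu] /=.
  have [b qb] := q_ne nu; split.
    exists b; first exact: joinedl (q_joined _ _ _ qb qb).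
    by apply/seteqP; split=> b' /=; [apply: q_joined | apply: q_closed].
  (* A bounded component would contain no point at depth [nu'], but [q] at depth [nu + nu'] is
     non-empty and contained in it. *)
  apply: contrapT => /far[nu' qfar].
  have [e qe] := q_ne (addp nu nu').
  apply: (qfar e); first by apply: q_le qe; rewrite num_addp lerDl.
  apply: (@sub_outside _ _ _ _ _ (addp nu nu')%:num); first by rewrite num_addp lerDr.
  exact: joinedl (q_joined _ _ _ qe qe).
apply/seteqP; split=> [b [c qc cb]|b qb].
  by apply: q_closed cb; apply: q_le qc.
have [c qc] := q_ne nu'; exists c => //.
by apply: q_joined => //; apply: q_le qc.
Qed.

(** Treating equivalence of ends as the relation induced by [id] brings it under the uniqueness and
    composition lemmas for [end_image]. *)
Lemma same_endP (X : Type) (d : X -> X -> R) (C : set X) p p1 :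
  (forall x y, d x y = d y x) -> scaled_ends d C p -> scaled_ends d C p1 ->
  same_end d C p p1 <-> end_image d C id p p1.
Proof.
move=> dC pE p1E; split=> [[r [_ _ pp1]]|].
  exists r%:num => nu; exists nu => a pa.
  have : rescale d C r%:num p.2 nu a.
    by exists a => //; apply: joinedxx; apply: end_outside pE pa.
  rewrite pp1 => -[b pb ba]; exists b => //; exact: joined_sym.
by move=> pp1; apply: (end_image_uniq dC dC pE pE p1E (end_image_id dC pE) pp1).
Qed.

Lemma same_end_sym (X : Type) (d : X -> X -> R) (C : set X) p p1 :
  same_end d C p p1 -> same_end d C p1 p.
Proof. by move=> [r [? ? ?]]; exists r; split. Qed.

Lemma same_end_trans (X : Type) (d : X -> X -> R) (C : set X) p p1 p2 :
  (forall x y, d x y = d y x) -> scaled_ends d C p -> scaled_ends d C p1 ->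
  scaled_ends d C p2 ->
  same_end d C p p1 -> same_end d C p1 p2 -> same_end d C p p2.
Proof.
move=> dC pE p1E p2E /same_end_sym/(same_endP dC p1E pE) p1p.
by move=> /(same_endP dC p1E p2E); apply: (end_image_uniq dC dC p1E pE p2E p1p).
Qed.

Lemma relatively_proper_id (X : Type) (d : X -> X -> R) (C : set X) :
  relatively_proper d d C C id.
Proof.
move=> nu; have mu_gt0 : 0 < Num.max nu 1 by rewrite lt_max ltr01 orbT.
by exists (PosNum mu_gt0); apply: sub_outside; rewrite /= le_max lexx.
Qed.

Lemma controlled_id (X : Type) (d : X -> X -> R) : controlled d d id.
Proof. by move=> r; exists r. Qed.

Lemma relatively_proper_comp (X Y Z : Type) (dX : X -> X -> R)
    (dY : Y -> Y -> R) (dZ : Z -> Z -> R) (C : set X) (D : set Y) (E : set Z)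
    (f : X -> Y) (g : Y -> Z) :
  relatively_proper dX dY C D f -> relatively_proper dY dZ D E g ->
  relatively_proper dX dZ C E (g \o f).
Proof.
move=> fp gp nu; have [mu {}gp] := gp nu; have [mu' {}fp] := fp mu%:num.
by exists mu' => x /fp/gp.
Qed.

(* Properness of [f] follows from its coarse inverse [g] sending [D] close to
   [C]. *)
Lemma coarse_inverse_proper (X Y : Type) (dX : X -> X -> R) (dY : Y -> Y -> R)
    (C : set X) (D : set Y) (f : X -> Y) (g : Y -> X) (K : R) :
  (forall x y z, dX x z <= dX x y + dX y z + K) ->
  controlled dY dX g -> (forall x, dX x (g (f x)) <= K) ->
  g @` D `<=` closed_nbhd dX K C ->
  relatively_proper dX dY C D f.
Proof.
move=> tri gc gfK gD nu; have [s gs] := gc nu.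
(* Two of the [K] are defects of the triangle inequality, the other two bound the distances from [x]
   to [g (f x)] and from [g y] to [C]. The added 1 makes the inequality strict. *)
have mu_gt0 : 0 < Num.max (K + s + K + K + K + 1) 1 by rewrite lt_max ltr01 orbT.
exists (PosNum mu_gt0) => x xout /= -[y Dy xy]; apply: xout.
have [c Cc yc] := gD (g y) (imageP _ Dy); exists c => //=.
rewrite lt_max; apply/orP; left.
have := gs _ _ (ltW xy); have := gfK x.
have := tri x (g (f x)) (g y); have := tri x (g y) c; lra.
Qed.

Lemma bounded_near (X : Type) (d : X -> X -> R) (C : set X) (K : R) :
  (forall x y z, d x z <= d x y + d y z + K) -> C !=set0 ->
  forall A : set X, ~ unbounded d A ->
    exists nu : {posnum R}, forall x, A x -> ~ outside d C nu%:num x.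
Proof.
move=> tri [c Cc] A /contrapT[r Ar].
have [[a Aa]|A0] := pselect (exists a, A a); last first.
  by exists (PosNum ltr01) => x Ax; case: A0; exists x.
have nu_gt0 : 0 < Num.max (r + d a c + K + 1) 1 by rewrite lt_max ltr01 orbT.
exists (PosNum nu_gt0) => x Ax; apply; exists c => //=.
rewrite lt_max; apply/orP; left.
have := Ar _ _ Ax Aa; have := tri x a c; lra.
Qed.

(* [dX] and [dY] need not be distances: the triangle inequality up to an additive
   constant is enough. *)
Lemma card_filtered_ends (X Y : Type) (dX : X -> X -> R) (dY : Y -> Y -> R)
    (C : set X) (D : set Y) (f : X -> Y) (g : Y -> X) (K : R) :
  (forall x y, dX x y = dX y x) -> (forall x y, dY x y = dY y x) ->
  (forall x y z, dX x z <= dX x y + dX y z + K) ->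
  (forall x y z, dY x z <= dY x y + dY y z + K) ->
  C !=set0 -> D !=set0 ->
  controlled dX dY f -> controlled dY dX g ->
  (forall x, dX x (g (f x)) <= K) -> (forall y, dY y (f (g y)) <= K) ->
  f @` C `<=` closed_nbhd dY K D -> g @` D `<=` closed_nbhd dX K C ->
  filtered_ends dX C #= filtered_ends dY D.
Proof.
move=> dXC dYC triX triY C0 D0 fc gc gfK fgK fCD gDC.
have fp := coarse_inverse_proper triX gc gfK gDC.
have gp := coarse_inverse_proper triY fc fgK fCD.
have fex p := end_image_ex (p := p) dXC dYC (bounded_near triY D0) fc fp.
have gex p := end_image_ex (p := p) dYC dXC (bounded_near triX C0) gc gp.
(* As [g \o f] is [K]-close to [id], going forth and back returns to the same end. *)
have gf_same p p1 p2 : scaled_ends dX C p -> scaled_ends dY D p1 ->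
    scaled_ends dX C p2 -> end_image dY D f p p1 -> end_image dX C g p1 p2 ->
    same_end dX C p p2.
  move=> pE p1E p2E pp1 p12; apply/same_endP => //.
  apply: (end_image_close (f := g \o f) (K := K) dXC pE) => //.
  - exact: relatively_proper_comp fp gp.
  - exact: relatively_proper_id.
  - exact: end_image_comp dYC p1E gc gp pp1 p12.
have fg_same p p1 p2 : scaled_ends dY D p -> scaled_ends dX C p1 ->
    scaled_ends dY D p2 -> end_image dX C g p p1 -> end_image dY D f p1 p2 ->
    same_end dY D p p2.
  move=> pE p1E p2E pp1 p12; apply/same_endP => //.
  apply: (end_image_close (f := f \o g) (K := K) dYC pE) => //.
  - exact: relatively_proper_comp gp fp.
  - exact: relatively_proper_id.
  - exact: end_image_comp dXC p1E fc fp pp1 p12.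
have f_same p p1 p2 : scaled_ends dX C p -> scaled_ends dX C p1 ->
    scaled_ends dY D p2 -> same_end dX C p p1 -> end_image dY D f p1 p2 ->
    end_image dY D f p p2.
  move=> pE p1E p2E /(same_endP dXC pE p1E) pp1 p12.
  by have := end_image_comp dXC p1E fc fp pp1 p12.
pose F (c : set ({posnum R} * ({posnum R} -> set X))) :=
  [set p1 | scaled_ends dY D p1 /\ exists2 p, scaled_ends dX C p /\ c p &
     end_image dY D f p p1].
(* [F] sends the class of [p] to the class of any one of its images. *)
have Fclass p p1 : scaled_ends dX C p -> scaled_ends dY D p1 ->
    end_image dY D f p p1 ->
    F [set q | scaled_ends dX C q /\ same_end dX C p q] =
    [set q | scaled_ends dY D q /\ same_end dY D p1 q].
  move=> pE p1E pp1; apply/seteqP; split=> q1 [q1E].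
    move=> [q [qE [_ pq]] qq1]; split=> //.
    apply: (end_image_uniq dXC dYC pE p1E q1E pp1).
    exact: f_same pE qE q1E pq qq1.
  move=> pq; split=> //; exists p.
    by do 2![split=> //]; apply/same_endP => //; apply: end_image_id.
  move/(same_endP dYC p1E q1E): pq => pq.
  exact: (end_image_comp dYC p1E (@controlled_id _ _) (@relatively_proper_id _ _ _)
    pp1 pq).
have bijF : set_bij (filtered_ends dX C) (filtered_ends dY D) F.
  split.
  - move=> c [p pE ->]; have [p1 p1E pp1] := fex _ pE.
    by exists p1 => //; apply: Fclass.
  - move=> c c' /set_mem[p pE ->] /set_mem[q qE ->].
    have [p1 p1E pp1] := fex _ pE; have [q1 q1E qq1] := fex _ qE.
    rewrite (Fclass _ p1) // (Fclass _ q1) // => pq.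
    (* Injectivity: [p1] is an image of both [p] and [q], so its image [p2] under [g] is equivalent
       to both. *)
    have [p2 p2E p12] := gex _ p1E.
    have q1p1 : same_end dY D q1 p1.
      suff [] : [set r | scaled_ends dY D r /\ same_end dY D q1 r] p1 by [].
      by rewrite -pq; split=> //; apply/same_endP => //; apply: end_image_id.
    have qp1 : end_image dY D f q p1.
      move/(same_endP dYC q1E p1E): q1p1 => q1p1.
      exact: (end_image_comp dYC q1E (@controlled_id _ _)
        (@relatively_proper_id _ _ _) qq1 q1p1).
    have pp2 := gf_same _ _ _ pE p1E p2E pp1 p12.
    have qp2 := gf_same _ _ _ qE p1E p2E qp1 p12.
    have qp := same_end_trans dXC qE p2E pE qp2 (same_end_sym pp2).
    apply/seteqP; split=> r [rE ?]; split=> //.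
      exact: (same_end_trans dXC qE pE rE qp).
    exact: (same_end_trans dXC pE qE rE (same_end_sym qp)).
  - move=> c [p1 p1E ->]; have [p pE p1p] := gex _ p1E.
    have [p2 p2E pp2] := fex _ pE.
    exists [set q | scaled_ends dX C q /\ same_end dX C p q]; first by exists p.
    have p12 := fg_same _ _ _ p1E pE p2E p1p pp2.
    rewrite (Fclass _ p2) //; apply/seteqP; split=> r [rE ?]; split=> //.
      exact: (same_end_trans dYC p1E p2E rE p12).
    exact: (same_end_trans dYC p2E p1E rE (same_end_sym p12)).
by apply/card_set_bijP; exists F.
Qed.

End EndImage.

(** * Word metrics and Cayley graphs *)

Section WordLength.
Local Open Scope group_scope.
Context {G : groupType} (S : seq G).
Hypothesis genS : generates S.

Lemma word_lengthP g : word_of_length S g (word_length S g).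
Proof.
rewrite /word_length; case: pselect => [ex|[]]; last exact: genS.
by case: ex_minnP => n /asboolP.
Qed.

Lemma word_length_le g n : word_of_length S g n -> (word_length S g <= n)%N.
Proof.
rewrite /word_length; case: pselect => // ex wn.
by case: ex_minnP => m _; apply; apply/asboolP.
Qed.

Lemma word_length1 : word_length S 1 = 0%N.
Proof.
by apply/eqP; rewrite -leqn0 word_length_le //; exists [::]; rewrite big_nil.
Qed.

Lemma word_lengthM g h :
  (word_length S (g * h) <= word_length S g + word_length S h)%N.
Proof.
have [v [sv vS vg]] := word_lengthP g; have [w [sw wS wh]] := word_lengthP h.
by apply: word_length_le; exists (v ++ w); rewrite size_cat all_cat big_cat
  sv sw vS wS /= vg wh.
Qed.

Lemma word_lengthV_le g : (word_length S g^-1 <= word_length S g)%N.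
Proof.
have [v [sv vS vg]] := word_lengthP g.
apply: word_length_le; exists (rev [seq x^-1 | x <- v]).
split; first by rewrite size_rev size_map.
  rewrite all_rev all_map (eq_all (a2 := fun x => (x \in S) || (x^-1 \in S))) //.
  by move=> x; rewrite /= invgK orbC.
by rewrite -vg -map_rev big_map prodgV revK.
Qed.

Lemma word_lengthV g : word_length S g^-1 = word_length S g.
Proof.
apply/eqP; rewrite eqn_leq word_lengthV_le /=.
by have := word_lengthV_le g^-1; rewrite invgK.
Qed.

Lemma word_length_gen s : s \in S -> (word_length S s <= 1)%N.
Proof.
by move=> sS; apply: word_length_le; exists [:: s]; rewrite /= sS big_seq1.
Qed.

(** A word of length [n + 1] is a letter times a word of length [n]. This local finiteness feeds
    [nbhd_finite_index] and [qi_invariant_cosets]. *)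
Lemma finite_ball n : finite_set [set g | (word_length S g <= n)%N].
Proof.
elim: n => [|n IHn].
  apply: sub_finite_set (finite_set1 (1 : G)) => g /=; rewrite leqn0 => /eqP g0.
  have := word_lengthP g; rewrite g0 => -[w [/size0nil -> _ <-]].
  by rewrite big_nil.
have fin := finite_image2 *%g (finite_seq (S ++ [seq x^-1 | x <- S])) IHn.
have : finite_set ([set g | (word_length S g <= n)%N] `|`
  [set x * y | x in [set` S ++ [seq x^-1 | x <- S]] &
               y in [set g | (word_length S g <= n)%N]]).
  by rewrite finite_setU.
apply: sub_finite_set => g /=.
rewrite leq_eqVlt => /orP[/eqP gn|]; last by left.
have [w [sw wS wg]] := word_lengthP g; right; rewrite gn in sw.
case: w sw wS wg => // s w [sw] /= /andP[sS wS]; rewrite big_cons => <-.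
exists s; last exists (\prod_(x <- w) x) => //.
  rewrite /= mem_cat; case/orP: sS => [->//|sS].
  by apply/orP; right; apply/mapP; exists s^-1; rewrite ?invgK.
by apply: word_length_le; exists w.
Qed.

Context {R : realType}.
Local Open Scope ring_scope.
Local Notation dist := (word_dist R S).
Implicit Types (g h : G).

Lemma word_dist_ge0 g h : 0 <= dist g h.
Proof. exact: ler0n. Qed.

Lemma word_distxx g : dist g g = 0.
Proof. by rewrite /word_dist mulVg word_length1. Qed.

Lemma word_distC g h : dist g h = dist h g.
Proof. by rewrite /word_dist -word_lengthV invgM invgK. Qed.

Lemma word_dist_tri g h k : dist g k <= dist g h + dist h k.
Proof.
rewrite /word_dist -natrD ler_nat.
by have := word_lengthM (g^-1 * h) (h^-1 * k); rewrite mulgA mulgK.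
Qed.

Lemma word_dist_mul2l k g h : dist (k * g)%g (k * h)%g = dist g h.
Proof. by rewrite /word_dist invgM mulgA mulgVK. Qed.

Lemma word_dist_gen g s : s \in S -> dist g (g * s)%g <= 1.
Proof. by move=> sS; rewrite /word_dist mulKg lern1 word_length_gen. Qed.

Lemma finite_word_ball g (r : R) : finite_set [set h | dist g h <= r].
Proof.
have /(finite_image ( *%g g)) := finite_ball (Num.truncn r).
apply: sub_finite_set => h /= hr; exists (g^-1 * h)%g; last by rewrite mulVKg.
by rewrite /= truncn_ge_nat // (le_trans _ hr).
Qed.

End WordLength.

Section CayleyGraphDistance.
Local Open Scope ring_scope.
Context (R : realType) {G : groupType} (S : seq G).
Hypothesis genS : generates S.

Local Notation X := (cayley_graph R S).
Local Notation dist := (word_dist R S).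
Local Notation gdist := (@edge_path_dist R G S).
Implicit Types p q : X.

Definition base_vertex p : G :=
  match p with Vertex g => g | EdgePoint g _ _ _ _ => g end.

Lemma edge_path_distC p q : gdist p q = gdist q p.
Proof.
(* The distance through endpoints is a minimum over four pairs of endpoints; exchanging the two
   edges transposes this array. *)
have minD (a b c e t r : R) :
    Num.min (r + Num.min (t + a) (1 - t + b)) (1 - r + Num.min (t + c) (1 - t + e)) =
    Num.min (t + Num.min (r + a) (1 - r + c)) (1 - t + Num.min (r + b) (1 - r + e)).
  rewrite !addr_minr minACA.
  by congr (Num.min (Num.min _ _) (Num.min _ _)); lra.
have distC := word_distC genS (R := R).
case: p q => [g|g s t sS t01] [h|h u r uS r01] /=.
- exact: distC.
- by rewrite distC (distC g (h * u)%g).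
- by rewrite distC (distC (g * s)%g).
rewrite (distC g h) (distC (g * s)%g h) (distC g) (distC (g * s)%g) minD.
by rewrite distrC (eq_sym g) (eq_sym s).
Qed.

Lemma dist_to_vertex_bound p h :
  dist (base_vertex p) h - 1 <= dist_to_vertex p h <= dist (base_vertex p) h + 1.
Proof.
case: p => [g|g s t sS /andP[t0 t1]] /=; first by apply/andP; split; lra.
have := word_dist_tri genS g (g * s)%g h (R := R).
have := word_dist_gen g sS (R := R) => d1 d2.
apply/andP; split; first by rewrite le_min; apply/andP; split; lra.
by rewrite ge_min; apply/orP; left; lra.
Qed.

(** Each of the two points contributes an error of at most 1 when replaced by its base vertex. *)
Lemma edge_path_dist_bound p q :
  dist (base_vertex p) (base_vertex q) - 2 <= gdist p q <=
  dist (base_vertex p) (base_vertex q) + 2.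
Proof.
case: q => [h|h u r uS /andP[r0 r1]] /=.
  by have /andP[] := dist_to_vertex_bound p h; move=> *; apply/andP; split; lra.
have /andP[a1 a2] := dist_to_vertex_bound p h.
have /andP[b1 b2] := dist_to_vertex_bound p (h * u)%g.
have d1 := word_dist_tri genS (base_vertex p) (h * u)%g h (R := R).
have := word_dist_gen h uS (R := R); rewrite word_distC // => d2.
set e := Num.min (r + _) _.
have /andP[e1 e2] : dist (base_vertex p) h - 2 <= e <= dist (base_vertex p) h + 2.
  rewrite le_min ge_min; apply/andP; split; last by apply/orP; left; lra.
  by apply/andP; split; lra.
case: p a1 a2 b1 b2 d1 e e1 e2 => [g|g s t sS /andP[t0 t1]] /= a1 a2 b1 b2 d1 e e1 e2.
  by rewrite e1 e2.
case: ifP => [/andP[/eqP gh _]|_]; last by rewrite e1 e2.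
rewrite le_min ge_min e1 e2 orbT !andbT gh word_distxx //.
have := normr_ge0 (t - r); lra.
Qed.

(** The defect 6 is the error 2 of [edge_path_dist_bound], once for each of the three distances. *)
Lemma edge_path_dist_tri p q r : gdist p r <= gdist p q + gdist q r + 6.
Proof.
have /andP[] := edge_path_dist_bound p q.
have /andP[] := edge_path_dist_bound q r.
have /andP[] := edge_path_dist_bound p r.
have := word_dist_tri genS (base_vertex p) (base_vertex q) (base_vertex r) (R := R).
lra.
Qed.

End CayleyGraphDistance.

(** * Hausdorff distance and quasi-isometries *)

Section HausdorffClose.
Local Open Scope ring_scope.
Context {R : realType}.

(** An explicit radius replaces the extended real [hdist]; [hdist_of_hclose] and [hclose_of_hdist]
    translate between the two. *)
Definition hclose (X : Type) (d : X -> X -> R) (r : R) (A B : set X) : Prop :=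
  A `<=` closed_nbhd d r B /\ B `<=` closed_nbhd d r A.

Definition coarsely_equal (X : Type) (d : X -> X -> R) (A B : set X) : Prop :=
  exists r, hclose d r A B.

Section OneSpace.
Context {X : Type} (d : X -> X -> R).
Implicit Types (A B E : set X) (r s : R).

Lemma hclose_sym r A B : hclose d r A B -> hclose d r B A.
Proof. by case. Qed.

Lemma sub_closed_nbhd r s A : r <= s -> closed_nbhd d r A `<=` closed_nbhd d s A.
Proof. by move=> rs x [a Aa xa]; exists a => //; apply: le_trans rs. Qed.

Lemma hclose_le r s A B : r <= s -> hclose d r A B -> hclose d s A B.
Proof.
by move=> rs [AB BA]; split; apply: subset_trans (sub_closed_nbhd rs).
Qed.

Lemma hdist_of_hclose r M A B : 0 <= r -> r < M -> hclose d r A B -> (hdist d A B < M%:E)%E.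
Proof.
move=> r0 rM [AB BA]; apply: (@le_lt_trans _ _ r%:E); last by rewrite lte_fin.
by apply: ereal_inf_lbound; exists r.
Qed.

Lemma hclose_of_hdist M A B : (hdist d A B < M%:E)%E -> hclose d M A B.
Proof.
by move=> /ereal_inf_lt[_ [r [r0 AB BA] <-]]; rewrite lte_fin => /ltW rM;
  apply: hclose_le rM _.
Qed.

Lemma coarsely_equal_sym A B : coarsely_equal d A B -> coarsely_equal d B A.
Proof. by move=> [r /hclose_sym]; exists r. Qed.

Hypothesis dtri : forall x y z, d x z <= d x y + d y z.

Lemma closed_nbhd_trans r s A B E : A `<=` closed_nbhd d r B ->
  B `<=` closed_nbhd d s E -> A `<=` closed_nbhd d (r + s) E.
Proof.
move=> AB BE a /AB[b /BE[e Ee be] ab]; exists e => //.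
by apply: le_trans (dtri a b e) _; apply: lerD.
Qed.

Lemma hclose_trans r s B A E : hclose d r A B -> hclose d s B E -> hclose d (r + s) A E.
Proof.
move=> [AB BA] [BE EB]; split; first exact: closed_nbhd_trans AB BE.
by rewrite addrC; apply: closed_nbhd_trans EB BA.
Qed.

Lemma coarsely_equal_trans B A E :
  coarsely_equal d A B -> coarsely_equal d B E -> coarsely_equal d A E.
Proof. by move=> [r AB] [s BE]; exists (r + s); apply: hclose_trans BE. Qed.

End OneSpace.

Lemma hclose_image (X Y : Type) (dX : X -> X -> R) (dY : Y -> Y -> R) (L C r : R)
    (f : X -> Y) (A B : set X) :
  0 <= L -> coarse_lipschitz dX dY L C f ->
  hclose dX r A B -> hclose dY (L * r + C) (f @` A) (f @` B).
Proof.
move=> L0 fLC [AB BA]; split=> _ [a + <-].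
  move=> /AB[b Bb ab]; exists (f b); first exact: imageP.
  by apply: le_trans (fLC _ _) _; rewrite lerD2r ler_wpM2l.
move=> /BA[b Bb ab]; exists (f b); first exact: imageP.
by apply: le_trans (fLC _ _) _; rewrite lerD2r ler_wpM2l.
Qed.

Lemma hclose_image_close (X Y : Type) (d : Y -> Y -> R) (C : R)
    (f g : X -> Y) (A : set X) :
  (forall x y, d x y = d y x) ->
  (forall x, d (f x) (g x) <= C) -> hclose d C (f @` A) (g @` A).
Proof.
move=> dC fg; split=> _ [a Aa <-].
  by exists (g a); [exact: imageP | exact: fg].
by exists (f a); [exact: imageP | rewrite dC; exact: fg].
Qed.

Lemma quasi_isometry_le (X Y : Type) (dX : X -> X -> R) (dY : Y -> Y -> R)
    (L C L' C' : R) (f : X -> Y) :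
  (forall x y, 0 <= dX x y) -> (forall x y, 0 <= dY x y) ->
  L <= L' -> C <= C' ->
  quasi_isometry dX dY L C f -> quasi_isometry dX dY L' C' f.
Proof.
move=> dX0 dY0 LL CC [fLC [g [gLC gf fg]]]; split.
  by move=> x y; apply: le_trans (fLC x y) _; rewrite lerD // ler_wpM2r.
exists g; split=> [x y|x|y]; last 2 first.
- exact: le_trans CC.
- exact: le_trans CC.
by apply: le_trans (gLC x y) _; rewrite lerD // ler_wpM2r.
Qed.

(** One additive constant covers four estimates: [L' * C + C'] and [L * C' + C] for the two
    composites, [L * C' + 2 * C] and [L' * C + 2 * C'] for their being coarse inverses. *)
Lemma quasi_isometry_comp (X Y Z : Type) (dX : X -> X -> R)
    (dY : Y -> Y -> R) (dZ : Z -> Z -> R) (L C L' C' : R)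
    (f : X -> Y) (g : Y -> Z) :
  (forall x y z, dX x z <= dX x y + dX y z) ->
  (forall x y z, dZ x z <= dZ x y + dZ y z) ->
  0 <= L -> 0 <= C -> 0 <= L' -> 0 <= C' ->
  quasi_isometry dX dY L C f -> quasi_isometry dY dZ L' C' g ->
  quasi_isometry dX dZ (L' * L) (L' * C + L * C' + 2 * (C + C')) (g \o f).
Proof.
move=> dXtri dZtri L0 C0 L'0 C'0 [fLC [f' [f'LC f'f ff']]] [gLC [g' [g'LC g'g gg']]].
have LC'0 : 0 <= L * C' by rewrite mulr_ge0.
have L'C0 : 0 <= L' * C by rewrite mulr_ge0.
split=> [x y|] /=.
  apply: le_trans (gLC _ _) _; have := ler_wpM2l L'0 (fLC x y).
  by rewrite mulrDr mulrA; lra.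
exists (f' \o g'); split=> [x y|x|y] /=.
- apply: le_trans (f'LC _ _) _; have := ler_wpM2l L0 (g'LC x y).
  by rewrite mulrDr mulrA (mulrC L); lra.
- have := dXtri (f' (g' (g (f x)))) (f' (f x)) x; have := f'f x.
  have := f'LC (g' (g (f x))) (f x); have := ler_wpM2l L0 (g'g (f x)); lra.
- have := dZtri (g (f (f' (g' y)))) (g (g' y)) y; have := gg' y.
  have := gLC (f (f' (g' y))) (g' y); have := ler_wpM2l L'0 (ff' (g' y)); lra.
Qed.

Lemma finite_uniform_bound (I : choiceType) (F : set I) (Q : I -> R -> Prop) :
  finite_set F -> (forall i r s, r <= s -> Q i r -> Q i s) ->
  (forall i, F i -> exists r, Q i r) ->
  exists2 r, 0 <= r & forall i, F i -> Q i r.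
Proof.
move=> /finite_seqP[s ->] Qle {F}; elim: s => [|i s IHs] Qex; first by exists 0.
have [|r r0 Qr] := IHs; first by move=> j js; apply: Qex; rewrite /= inE js orbT.
have [r' Qr'] := Qex i (mem_head _ _).
exists (Num.max r r'); first by rewrite le_max r0.
move=> j; rewrite /= inE => /predU1P[->|js].
  by apply: Qle Qr'; rewrite le_max lexx orbT.
by apply: Qle (Qr _ js); rewrite le_max lexx.
Qed.

End HausdorffClose.

(** * Commensurators *)

Section Cosets.
Local Open Scope group_scope.
Context {G : groupType}.
Implicit Types (g h : G) (A B P : set G).

Lemma subgroup1 P : is_subgroup P -> P 1.
Proof. by case=> /set_mem. Qed.

Lemma subgroupV P g : is_subgroup P -> P g -> P g^-1.
Proof. by move=> /group_closedV PV /mem_set/PV/set_mem. Qed.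

Lemma subgroupM P g h : is_subgroup P -> P g -> P h -> P (g * h).
Proof. by move=> /group_closedM PM /mem_set Pg /mem_set/(PM _ _ Pg)/set_mem. Qed.

Lemma is_subgroupP P : P 1 -> (forall g h, P g -> P h -> P (g * h^-1)) ->
  is_subgroup P.
Proof.
move=> P1 PM; split; first exact: mem_set.
by move=> g h /set_mem Pg /set_mem Ph; apply: mem_set; apply: PM.
Qed.

Lemma lcosetM g h A : lcoset (g * h) A = lcoset g (lcoset h A).
Proof. by rewrite /lcoset image_comp; apply: eq_imagel => x _ /=; rewrite mulgA. Qed.

Lemma lcoset1 A : lcoset 1 A = A.
Proof. by apply: eq_image_id => x _; rewrite mul1g. Qed.

Lemma lcosetK g A : lcoset g^-1 (lcoset g A) = A.
Proof. by rewrite -lcosetM mulVg lcoset1. Qed.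

Lemma lcosetVK g A : lcoset g (lcoset g^-1 A) = A.
Proof. by rewrite -lcosetM mulgV lcoset1. Qed.

Lemma lcoset_id P g : is_subgroup P -> P g -> lcoset g P = P.
Proof.
move=> sP Pg; apply/seteqP; split=> [_ [x Px <-]|x Px]; first exact: subgroupM.
by exists (g^-1 * x); rewrite ?mulVKg //; exact: subgroupM sP (subgroupV sP Pg) Px.
Qed.

Lemma lcoset_eq P g h : is_subgroup P -> lcoset g P h -> lcoset g P = lcoset h P.
Proof. by move=> sP [x Px <-]; rewrite lcosetM (lcoset_id sP Px). Qed.

Lemma mem_lcoset A g x : A x -> lcoset g A (g * x).
Proof. by move=> Ax; exists x. Qed.

Lemma conjugate_subgroup P g : is_subgroup P -> is_subgroup (conjugate g P).
Proof.
move=> sP; apply: is_subgroupP.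
  by exists 1; [exact: subgroup1 | rewrite mulg1 mulgV].
move=> _ _ [x Px <-] [y Py <-]; exists (x * y^-1).
  exact: subgroupM sP Px (subgroupV sP Py).
by rewrite !invgM invgK !mulgA mulgVK.
Qed.

Lemma setI_subgroup P A : is_subgroup P -> is_subgroup A -> is_subgroup (P `&` A).
Proof.
move=> sP sA; apply: is_subgroupP; first by split; apply: subgroup1.
move=> g h [Pg Ag] [Ph Ah]; split.
  exact: subgroupM sP Pg (subgroupV sP Ph).
exact: subgroupM sA Ag (subgroupV sA Ah).
Qed.

End Cosets.

Section Commensurator.
Context {R : realType} {G : groupType} (S : seq G).
Hypothesis genS : generates S.
Local Notation dist := (word_dist R S).
Local Open Scope ring_scope.
Implicit Types (A B P : set G) (g h : G).

Let dC := word_distC genS (R := R).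
Let dtri := word_dist_tri genS (R := R).

Lemma hclose_lcoset g r A B :
  hclose dist r A B -> hclose dist r (lcoset g A) (lcoset g B).
Proof.
move=> AB; rewrite -[r]mul1r -[X in hclose _ X]addr0.
by apply: hclose_image AB => // x y; rewrite word_dist_mul2l mul1r addr0.
Qed.

Lemma coarsely_equal_lcoset g A B :
  coarsely_equal dist A B -> coarsely_equal dist (lcoset g A) (lcoset g B).
Proof. by move=> [r AB]; exists r; apply: hclose_lcoset. Qed.

Lemma finite_index_nbhd (K A : set G) : is_subgroup K -> is_subgroup A ->
  finite_index K A -> exists r : R, A `<=` closed_nbhd dist r K.
Proof.
move=> sK sA fin.
(* Sorting by the left coset of [a^-1] amounts to sorting by the right coset of [a]: the metric is
   left-invariant, so each right coset of [K] stays at bounded distance from [K]. *)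
pose Q X (r : R) := forall a, A a -> lcoset a^-1%g K = X -> closed_nbhd dist r K a.
have [X r s rs Qr a Aa aX|X [a0 Aa0 a0X]|r _ Qr] := finite_uniform_bound (Q := Q) fin.
- exact: sub_closed_nbhd rs _ (Qr a Aa aX).
- exists (dist 1%g a0^-1%g) => a Aa aX.
  have : lcoset a^-1%g K a^-1%g.
    by exists 1%g; [exact: subgroup1 | rewrite mulg1].
  rewrite aX -a0X => -[k Kk ka]; exists k^-1%g; first exact: subgroupV.
  have -> : a = (k^-1 * a0^-1)%g by rewrite -invgM ka invgK.
  by rewrite dC -{1}[k^-1%g]mulg1 word_dist_mul2l.
- by exists r => a Aa; apply: (Qr (lcoset a^-1%g K)) => //; exists a^-1%g => //;
    apply: subgroupV.
Qed.

(* If b in B is close to a^-1, the coset of a modulo A `&` B is the intersection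
   of A with u B, where u = a b lies in a fixed ball. *)
Lemma nbhd_finite_index (A B : set G) (r : R) : is_subgroup A -> is_subgroup B ->
  A `<=` closed_nbhd dist r B -> finite_index (A `&` B) A.
Proof.
move=> sA sB AB.
apply: sub_finite_set (finite_image (fun u => lcoset u B `&` A)
  (finite_word_ball genS 1%g r)) => _ [a Aa <-].
have [b Bb ab] := AB _ (subgroupV sA Aa).
exists (a * b)%g; first by rewrite /= -(mulgV a) word_dist_mul2l.
rewrite lcosetM (lcoset_id sB Bb); apply/seteqP; split=> [_ [[c Bc <-] Aac]|_ [c [Ac Bc] <-]].
  exists c => //; split=> //; rewrite -(mulKg a c).
  exact: subgroupM sA (subgroupV sA Aa) Aac.
by split; [exact: mem_lcoset | exact: subgroupM].
Qed.

Lemma conjugate_nbhd g P :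
  lcoset g P `<=` closed_nbhd dist (dist 1%g g^-1%g) (conjugate g P) /\
  conjugate g P `<=` closed_nbhd dist (dist 1%g g^-1%g) (lcoset g P).
Proof.
have d x : dist x (x * g^-1)%g = dist 1%g g^-1%g.
  by rewrite -{1}[x]mulg1 word_dist_mul2l.
split=> _ [x Px <-].
  by exists (g * x * g^-1)%g; [exists x | rewrite d].
by exists (g * x)%g; [exists x | rewrite dC d].
Qed.

(** A conjugate of [P] by [g] is at bounded distance from [lcoset g P], and for subgroups an
    intersection of finite index means lying in a bounded neighborhood of the other subgroup. *)
Lemma commensurator_coarsely_equal P g : is_subgroup P ->
  commensurator P g <-> coarsely_equal dist P (lcoset g P).
Proof.
move=> sP; have sgP := conjugate_subgroup g sP.
have [gPc cgP] := conjugate_nbhd g P; split=> [[fin1 fin2]|[r [PgP gPP]]].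
  have sI := setI_subgroup sP sgP.
  have [r1 Pr1] := finite_index_nbhd sI sP fin1.
  have [r2 Pr2] := finite_index_nbhd sI sgP fin2.
  set s := dist 1%g g^-1%g in gPc cgP.
  have P1 : P `<=` closed_nbhd dist (r1 + s) (lcoset g P).
    apply: closed_nbhd_trans cgP => //.
    by apply: subset_trans Pr1 _ => x [k [_ ?] xk]; exists k.
  have P2 : lcoset g P `<=` closed_nbhd dist (s + r2) P.
    apply: closed_nbhd_trans gPc _ => //.
    by apply: subset_trans Pr2 _ => x [k [? _] xk]; exists k.
  exists (Num.max (r1 + s) (s + r2)); split.
    by apply: subset_trans P1 _; apply: sub_closed_nbhd; rewrite le_max lexx.
  by apply: subset_trans P2 _; apply: sub_closed_nbhd; rewrite le_max lexx orbT.
split.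
  exact: nbhd_finite_index sP sgP (closed_nbhd_trans dtri PgP gPc).
rewrite setIC; exact: nbhd_finite_index sgP sP (closed_nbhd_trans dtri cgP gPP).
Qed.

End Commensurator.

(** * Families of subsets permuted by quasi-isometries *)

Section QIInvariantFamilies.
Local Open Scope ring_scope.
Context (R : realType).

(** These properties of the cosets of a qi-characteristic collection survive transport by a
    quasi-isometry, where members cease to be cosets. The last two fields stand for finiteness of
    the collection and finite index in commensurators. *)
Record qi_invariant (G : groupType) (S : seq G) (F : set (set G)) : Prop := {
  qi_invariant_ne : forall A, F A -> A !=set0;
  qi_invariant_near : forall L C : R, 1 <= L -> 0 <= C -> exists2 M : R, 0 <= M &
    forall f, quasi_isometry (word_dist R S) (word_dist R S) L C f ->
      (forall A, F A -> exists2 B, F B & hclose (word_dist R S) M (f @` A) B) /\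
      (forall B, F B -> exists2 A, F A & hclose (word_dist R S) M (f @` A) B);
  qi_invariant_ball : forall r : R,
    finite_set [set A | F A /\ exists2 a, A a & word_dist R S 1%g a <= r];
  qi_invariant_class : forall A, F A ->
    finite_set [set B | F B /\ coarsely_equal (word_dist R S) A B]
}.

Lemma qi_invariant_cosets (G : groupType) (S : seq G) (PP : set (set G)) :
  generates S -> qi_characteristic R S PP -> qi_invariant S (cosets PP).
Proof.
move=> genS [sub fin comm qi]; have dtri := word_dist_tri genS (R := R).
split.
- move=> _ [g [P [/sub sP ->]]]; exists (g * 1)%g; apply: mem_lcoset.
  exact: subgroup1.
- move=> L C L1 C0; have [M M0 MP] := qi L C L1 C0; exists M; first exact: ltW.
  move=> f /MP[_ fA fB]; split=> A.
    by move=> /fA[B BPP /hclose_of_hdist]; exists B.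
  by move=> /fB[B BPP /hclose_of_hdist]; exists B.
- move=> r; apply: sub_finite_set (finite_image2 lcoset
    (finite_word_ball genS 1%g r) fin) => _ [[g [P [PPP ->]]] [a gPa ar]].
  exists a => //; exists P => //.
  by rewrite (lcoset_eq (sub _ PPP) gPa).
move=> A _; apply: (@sub_finite_set _ _ (\bigcup_(P in PP)
    [set B | (exists g, B = lcoset g P) /\ coarsely_equal (word_dist R S) A B])).
  by move=> _ [[g [P [PPP ->]]] AgP]; exists P => //; split=> //; exists g.
apply: bigcup_finite => // P PPP; set B := (X in finite_set X).
(* Once one coset [lcoset h P] is coarsely equal to [A], any other such [lcoset g P] has [h^-1 * g]
   in the commensurator, hence finitely many cosets occur. *)
have [[_ [[h ->] AhP]]|B0] := pselect (B !=set0); last first.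
  by have -> : B = set0; [apply: contrapT => /eqP/set0P | exact: finite_set0].
apply: sub_finite_set (finite_image (lcoset h) (comm P PPP)) => _ [[g ->] AgP].
exists (lcoset (h^-1 * g)%g P); last by rewrite -lcosetM mulVKg.
exists (h^-1 * g)%g => //; apply/(commensurator_coarsely_equal genS (R := R)).
  exact: sub.
rewrite lcosetM -[P in X in coarsely_equal _ X](lcosetK h).
apply: coarsely_equal_lcoset => //.
exact: coarsely_equal_trans (coarsely_equal_sym AhP) AgP.
Qed.

Lemma qi_invariant_image (G H : groupType) (S : seq G) (T : seq H) (L C : R)
    (q : G -> H) (F : set (set G)) :
  generates S -> generates T -> 1 <= L -> 0 <= C ->
  quasi_isometry (word_dist R S) (word_dist R T) L C q ->
  qi_invariant S F -> qi_invariant T [set q @` A | A in F].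
Proof.
move=> genS genT L1 C0 qi_q [ne inv ball class].
have [qLC [q' [q'LC q'q qq']]] := qi_q.
have qi_q' : quasi_isometry (word_dist R T) (word_dist R S) L C q'.
  by split=> //; exists q.
have L0 : 0 <= L by apply: le_trans L1.
have [dSC dTC] := (word_distC genS (R := R), word_distC genT (R := R)).
have [dStri dTtri] := (word_dist_tri genS (R := R), word_dist_tri genT (R := R)).
split.
- by move=> _ [A /ne[a Aa] <-]; exists (q a); apply: imageP.
- move=> L' C' L'1 C'0; have L'0 : 0 <= L' by apply: le_trans L'1.
  (* By [quasi_isometry_comp], these are the constants of [f \o q]; [L2'] and [C2'] below are those
     of [q' \o (f \o q)]. *)
  set L1' := L' * L; set C1' := L' * C + L * C' + 2 * (C + C').
  have L1'1 : 1 <= L1' by rewrite -[1]mulr1 ler_pM.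
  have [p1 p2] : 0 <= L' * C /\ 0 <= L * C' by rewrite !mulr_ge0.
  have C1'0 : 0 <= C1' by rewrite /C1'; lra.
  have L1'0 : 0 <= L1' by apply: le_trans L1'1.
  set L2' := L * L1'; set C2' := L * C1' + L1' * C + 2 * (C1' + C).
  have L2'1 : 1 <= L2' by rewrite -[1]mulr1 ler_pM.
  have [p3 p4] : 0 <= L * C1' /\ 0 <= L1' * C by rewrite !mulr_ge0.
  have C2'0 : 0 <= C2' by rewrite /C2'; lra.
  have [M M0 MP] := inv L2' C2' L2'1 C2'0.
  have LM0 : 0 <= L * M by rewrite mulr_ge0.
  exists (C + (L * M + C)); first lra.
  move=> f qi_f.
  have [] := MP (q' \o (f \o q)).
    apply: quasi_isometry_comp qi_q' => //.
    exact: quasi_isometry_comp qi_f.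
  have step A B : hclose (word_dist R S) M ((q' \o (f \o q)) @` A) B ->
      hclose (word_dist R T) (C + (L * M + C)) (f @` (q @` A)) (q @` B).
    move=> AB; apply: (hclose_trans dTtri (B := q @` ((q' \o (f \o q)) @` A))) => //.
      rewrite !image_comp; apply: hclose_image_close => // x /=.
      by rewrite dTC; apply: qq'.
    exact: hclose_image AB.
  move=> fA fB; split=> _ [A FA <-].
    by have [B FB AB] := fA _ FA; exists (q @` B); [exists B | exact: step].
  by have [B FB AB] := fB _ FA; exists (q @` B); [exists B | exact: step].
- move=> r; apply: sub_finite_set (finite_image (image^~ q)
    (ball (word_dist R S 1%g (q' 1%g) + (L * r + C) + C))).
  move=> _ [[A FA <-] [_ [a Aa <-] ar]]; exists A => //; split=> //; exists a => //.
  have := q'q a; have := q'LC 1%g (q a).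
  have := dStri 1%g (q' 1%g) a; have := dStri (q' 1%g) (q' (q a)) a.
  have := ler_wpM2l L0 ar; lra.
move=> _ [A FA <-]; apply: sub_finite_set (finite_image (image^~ q) (class A FA)).
move=> _ [[B FB <-] [r AB]]; exists B => //; split=> //.
(* Applying [q'] to the images costs [L * r + C]; returning to [A] and to [B] costs [C] each. *)
exists (C + ((L * r + C) + C)).
have closeq E : hclose (word_dist R S) C E (q' @` (q @` E)).
  rewrite image_comp -{1}[E]image_id; apply: hclose_image_close => // x /=.
  by rewrite dSC; apply: q'q.
apply: (hclose_trans dStri (closeq A)).
apply: (hclose_trans dStri _ (hclose_sym (closeq B))).
exact: hclose_image AB.
Qed.

End QIInvariantFamilies.

(** * Stabilizers of coarse classes *)

Section CoarseStabilizer.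
Local Open Scope ring_scope.
Context (R : realType) {G : groupType} (S : seq G).
Hypothesis genS : generates S.
Local Notation dist := (word_dist R S).
Implicit Types (A B : set G) (F : set (set G)).

Let dC := word_distC genS (R := R).
Let dtri := word_dist_tri genS (R := R).

Definition coarse_stabilizer A : set G :=
  [set h | coarsely_equal dist A (lcoset h A)].

Lemma coarsely_equal_lcosetV g A B :
  coarsely_equal dist A (lcoset g B) -> coarsely_equal dist (lcoset g^-1%g A) B.
Proof. by move/(coarsely_equal_lcoset g^-1%g); rewrite lcosetK. Qed.

Lemma coarse_stabilizer_subgroup A : is_subgroup (coarse_stabilizer A).
Proof.
apply: is_subgroupP => [|g h Ag Ah].
  rewrite /coarse_stabilizer /= lcoset1; exists 0.
  by split=> a Aa; exists a => //; rewrite word_distxx.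
apply: (coarsely_equal_trans dtri Ag); rewrite lcosetM.
apply: coarsely_equal_lcoset => //; apply: coarsely_equal_sym.
exact: coarsely_equal_lcosetV.
Qed.

Lemma quasi_isometry_mulg g : quasi_isometry dist dist 1 0 (fun x => g * x)%g.
Proof.
split=> [x y|]; first by rewrite word_dist_mul2l mul1r addr0.
exists (fun x => g^-1 * x)%g; split=> [x y|x|x].
- by rewrite word_dist_mul2l mul1r addr0.
- by rewrite mulKg word_distxx.
- by rewrite mulVKg word_distxx.
Qed.

Lemma qi_invariant_lcoset F : qi_invariant R S F -> exists2 M : R, 0 <= M &
  forall g A, F A -> exists2 B, F B & hclose dist M (lcoset g A) B.
Proof.
case=> _ inv _ _; have [M M0 MP] := inv 1 0 (lexx _) (lexx _); exists M => // g.
by have [] := MP _ (quasi_isometry_mulg g).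
Qed.

(* For y in A, the translate of A by a y^-1 passes through a, so it is close to
   one of the finitely many members of F near a; if this member is the same for
   y and y0, then y y0^-1 stabilizes the coarse class of A. *)
Lemma coarsely_equal_stabilizer F A : qi_invariant R S F -> F A ->
  coarsely_equal dist (coarse_stabilizer A) A.
Proof.
move=> Finv FA; have [M M0 MP] := qi_invariant_lcoset Finv.
have [ne _ ball class] := Finv; have [a Aa] := ne _ FA.
(* The coarse class of [A] in [F] is finite, so a single [D] bounds the distance from [A] to all its
   members. *)
have [B s t st|B [_ [r AB]]|D D0 DP] :=
    finite_uniform_bound (Q := fun B r => hclose dist r A B) (class A FA).
- exact: hclose_le.
- by exists r.
pose Q B (r : R) := forall y, A y -> hclose dist M (lcoset (a * y^-1)%g A) B ->
  closed_nbhd dist r (coarse_stabilizer A) y.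
have [B r s rs Qr y Ay yB|B [FB _]|r r0 Qr] :=
    finite_uniform_bound (Q := Q) (ball (dist 1%g a + M)).
- exact: sub_closed_nbhd rs _ (Qr y Ay yB).
- have [[y0 Ay0 y0B]|noy] := pselect (exists2 y0, A y0 &
      hclose dist M (lcoset (a * y0^-1)%g A) B); last first.
    by exists 0 => y Ay yB; case: noy; exists y.
  exists (dist 1%g y0^-1%g) => y Ay yB.
  exists (y * y0^-1)%g; last by rewrite -{1}[y]mulg1 word_dist_mul2l.
  have : coarsely_equal dist (lcoset (a * y^-1)%g A) (lcoset (a * y0^-1)%g A).
    exists (M + M); apply: (hclose_trans dtri yB); exact: hclose_sym.
  move/(coarsely_equal_lcoset (y * a^-1)%g).
  by rewrite -!lcosetM mulgA mulgVK mulgV lcoset1 mulgA mulgVK.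
have sub : A `<=` closed_nbhd dist r (coarse_stabilizer A).
  move=> y Ay; have [B FB yB] := MP (a * y^-1)%g A FA; apply: (Qr B) => //.
  split=> //; have [|b Bb ab] := yB.1 a.
    by exists y => //; rewrite mulgVK.
  by exists b => //; apply: le_trans (dtri _ a _) _; rewrite lerD2l.
exists (Num.max r (dist 1%g a + (M + D))); split; last first.
  by apply: subset_trans sub _; apply: sub_closed_nbhd; rewrite le_max lexx.
(* The translate of [A] by [k] is [M]-close to some [B] in the coarse class of [A], hence [D]-close
   to [A]; so [k * a], and with it [k], is near [A]. *)
move=> k Ak; have [B FB kB] := MP k A FA.
have AB : hclose dist D A B.
  by apply: DP; split=> //; apply: (coarsely_equal_trans dtri Ak); exists M.
have [] := hclose_trans dtri kB (hclose_sym AB) => /(_ _ (mem_lcoset k Aa)).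
move=> [c Ac kac] _; exists c => //; rewrite le_max; apply/orP; right.
apply: le_trans (dtri _ (k * a)%g _) _; apply: lerD kac.
by rewrite -{1}[k]mulg1 word_dist_mul2l.
Qed.

(** The collection consists of the stabilizers of the finitely many members of [F] meeting a fixed
    ball. Their cosets are uniformly close to the members of [F] and conversely, so they inherit the
    behavior of [F] under quasi-isometries. *)
Lemma qi_subcharacteristic_coarse_stabilizer F A : qi_invariant R S F -> F A ->
  qi_subcharacteristic R S (coarse_stabilizer A).
Proof.
move=> Finv FA; have [M M0 MP] := qi_invariant_lcoset Finv.
have [ne inv ball class] := Finv; have [a Aa] := ne _ FA.
(* Radius [M] catches a member close to some translate of any given one; radius [dist 1 a] ensures
   that [A] itself is included. *)
pose r := Num.max M (dist 1%g a).
pose F0 := [set B | F B /\ exists2 b, B b & dist 1%g b <= r].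
have [B s t st|B [FB _]|D D0 DP] := finite_uniform_bound
    (Q := fun B s => hclose dist s (coarse_stabilizer B) B) (ball r).
- exact: hclose_le.
- exact: coarsely_equal_stabilizer Finv FB.
have toF X : cosets [set coarse_stabilizer B | B in F0] X ->
    exists2 B, F B & hclose dist (D + M) X B.
  move=> [h [_ [[B F0B <-] ->]]]; have [B' FB' BB'] := MP h B F0B.1.
  exists B' => //; apply: (hclose_trans dtri _ BB').
  exact/hclose_lcoset/DP.
have ofF B : F B -> exists2 X, cosets [set coarse_stabilizer B | B in F0] X &
    hclose dist (D + M) X B.
  move=> FB; have [b Bb] := ne _ FB; have [B' FB' BB'] := MP b^-1%g B FB.
  have F0B' : F0 B'.
    split=> //; have [|b' B'b' d] := BB'.1 1%g; first by exists b; rewrite ?mulVg.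
    by exists b' => //; rewrite le_max d.
  exists (lcoset b (coarse_stabilizer B')).
    by exists b, (coarse_stabilizer B'); split=> //; exists B'.
  apply: (hclose_trans dtri (B := lcoset b B')); first exact/hclose_lcoset/DP.
  by apply: hclose_sym; rewrite -[B](lcosetVK b); apply: hclose_lcoset.
exists [set coarse_stabilizer B | B in F0]; last first.
  by exists A => //; split=> //; exists a; rewrite // le_max lexx orbT.
split.
- by move=> _ [B _ <-]; apply: coarse_stabilizer_subgroup.
- exact: finite_image (ball r).
- move=> _ [B F0B <-].
  apply: sub_finite_set (finite_set1 (coarse_stabilizer B)) => _ [g gB <-].
  have sB := coarse_stabilizer_subgroup B.
  apply: lcoset_id => //.
  have sBB : coarsely_equal dist (coarse_stabilizer B) B by exists D; apply: DP.
  (* An element commensurating the stabilizer of [B] preserves its coarse class, which is that of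
     [B]; so the stabilizer is its own commensurator. *)
  apply: (coarsely_equal_trans dtri (coarsely_equal_sym sBB)).
  move/(commensurator_coarsely_equal genS (R := R) _ sB): gB => gB.
  apply: (coarsely_equal_trans dtri gB); exact: coarsely_equal_lcoset.
move=> L C L1 C0; have L0 : 0 <= L by apply: le_trans L1.
have [M1 M10 M1P] := inv L C L1 C0.
(* The terms bound the passages from [f @] X[to]f @[B], then to [B'], then to [X']. *)
pose s := (L * (D + M) + C) + M1 + (D + M).
have s0 : 0 <= s by rewrite !addr_ge0 // mulr_ge0 // addr_ge0.
exists (s + 1); first lra.
move=> f qi_f; have [fA fB] := M1P f qi_f.
have fclose X B B' X' : hclose dist (D + M) X B -> hclose dist M1 (f @` B) B' ->
    hclose dist (D + M) X' B' -> (hdist dist (f @` X) X' < (s + 1)%:E)%E.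
  move=> XB BB' XB'; apply: (@hdist_of_hclose _ _ _ s) => //; first lra.
  apply: (hclose_trans dtri _ (hclose_sym XB')).
  by apply: (hclose_trans dtri _ BB'); apply: hclose_image XB => //; case: qi_f.
split=> // X.
  move=> /toF[B FB XB]; have [B' FB' BB'] := fA B FB.
  by have [X' X'c X'B'] := ofF B' FB'; exists X' => //; apply: fclose XB BB' X'B'.
move=> /toF[B' FB' X'B']; have [B FB BB'] := fB B' FB'.
by have [X' X'c X'B] := ofF B FB; exists X' => //; apply: fclose X'B BB' X'B'.
Qed.

End CoarseStabilizer.

(** * Passage to Cayley graphs, and the conclusion *)

Lemma card_filtered_ends_of_pair (R : realType) (G H : groupType) (S : seq G)
    (T : seq H) (L C r : R) (q : G -> H) (P : set G) (Q : set H) :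
  generates S -> generates T -> (1 <= L)%R -> (0 <= C)%R -> (0 <= r)%R ->
  quasi_isometry (word_dist R S) (word_dist R T) L C q ->
  P !=set0 -> Q !=set0 -> hclose (word_dist R T) r (q @` P) Q ->
  filtered_ends_of_pair R S P #= filtered_ends_of_pair R T Q.
Proof.
move=> genS genT L1 C0 r0 [qLC [q' [q'LC q'q qq']]] [x Px] [y Qy] [PQ QP].
have L0 : (0 <= L)%R by apply: le_trans L1.
have Lr0 : (0 <= L * r)%R by rewrite mulr_ge0.
have control (G1 H1 : groupType) (S1 : seq G1) (T1 : seq H1) (f : G1 -> H1) :
    generates S1 ->
    coarse_lipschitz (word_dist R S1) (word_dist R T1) L C f ->
    controlled (@edge_path_dist R G1 S1) (@edge_path_dist R H1 T1)
      (fun p => Vertex (f (base_vertex p))).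
  move=> genS1 fLC s; exists (L * (s + 2) + C)%R => p1 p2 ps /=.
  apply: le_trans (fLC _ _) _; rewrite lerD2r ler_wpM2l //.
  have /andP[] := edge_path_dist_bound genS1 p1 p2; lra.
have close (G1 : groupType) (S1 : seq G1) (f : G1 -> G1) : generates S1 ->
    (forall x, (word_dist R S1 (f x) x <= C)%R) -> forall p,
    (@edge_path_dist R G1 S1 p (Vertex (f (base_vertex p))) <= C + 1)%R.
  move=> genS1 fC p; have := fC (base_vertex p); rewrite word_distC //= => pC.
  have /andP[] := dist_to_vertex_bound genS1 p (f (base_vertex p)); lra.
(* [K] dominates the triangle defect 6, the closeness [C + 1] of the composites to the identity, the
   distance [r] from [q @] P[to]Q[, and the bound]L * r + C + C[for points of]q' @[Q]. *)
pose K := (L * r + C + C + r + 6)%R.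
apply: (card_filtered_ends (K := K) (f := fun p => Vertex (q (base_vertex p)))
  (g := fun p => Vertex (q' (base_vertex p)))).
- exact: edge_path_distC.
- exact: edge_path_distC.
- by move=> p1 p2 p3; have := edge_path_dist_tri genS p1 p2 p3; rewrite /K; lra.
- by move=> p1 p2 p3; have := edge_path_dist_tri genT p1 p2 p3; rewrite /K; lra.
- by exists (Vertex x), x.
- by exists (Vertex y), y.
- exact: control.
- exact: control.
- by move=> p; have := close _ _ _ genS q'q p; rewrite /K /=; lra.
- by move=> p; have := close _ _ _ genT qq' p; rewrite /K /=; lra.
- move=> _ [_ [z Pz <-] <-] /=; have [|b Qb zb] := PQ (q z); first exact: imageP.
  by exists (Vertex b); [exists b | rewrite /K /=; lra].
move=> _ [_ [z Qz <-] <-] /=; have [_ [b Pb <-] zb] := QP z Qz.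
exists (Vertex b); first by exists b.
have := q'LC z (q b); have := ler_wpM2l L0 zb; have := q'q b.
have := word_dist_tri genS (q' z) (q' (q b)) b (R := R); rewrite /K /=; lra.
Qed.

Theorem corollary1p2 (R : realType) (G H : groupType) (S : seq G) (T : seq H)
    (genS : generates S) (genT : generates T)
    (qiGH : quasi_isometric (word_dist R S) (word_dist R T))
    (P : set G) (subcharP : qi_subcharacteristic R S P) :
  exists Q : set H,
    qi_subcharacteristic R T Q /\
    filtered_ends_of_pair R S P #= filtered_ends_of_pair R T Q.
Proof.
have [PP charPP PPP] := subcharP; have [L [C [q qi0]]] := qiGH.
(* The constants given by [quasi_isometric] are arbitrary reals; they are enlarged to satisfy
   [1 <= L] and [0 <= C]. *)
have L1 : (1 <= Num.max L 1)%R by rewrite le_max lexx orbT.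
have C0 : (0 <= Num.max C 0)%R by rewrite le_max lexx orbT.
have qi_q : quasi_isometry (word_dist R S) (word_dist R T)
    (Num.max L 1)%R (Num.max C 0)%R q.
  by apply: quasi_isometry_le qi0; rewrite // ?le_max ?lexx //;
    apply: word_dist_ge0.
have invG := qi_invariant_cosets genS charPP.
have invH := qi_invariant_image genS genT L1 C0 qi_q invG.
have FP : [set q @` A | A in cosets PP] (q @` P).
  by exists P => //; exists 1%g, P; rewrite lcoset1.
have [r [Qr rQ]] := coarsely_equal_stabilizer genT invH FP.
exists (coarse_stabilizer R T (q @` P)); split.
  exact: qi_subcharacteristic_coarse_stabilizer invH FP.
have [sub _ _ _] := charPP.
apply: (card_filtered_ends_of_pair (r := Num.max r 0%R) genS genT L1 C0 _ qi_q).
- by rewrite le_max lexx orbT.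
- by exists 1%g; apply: subgroup1; apply: sub.
- by exists 1%g; apply: subgroup1; apply: coarse_stabilizer_subgroup.
by apply: (hclose_le (r := r)); [rewrite le_max lexx | split].
Qed.
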